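(* Let $a,n\in\mathbb{N}$ with $a\ge 2$ and $n\ge 1$, and let $w=(w_0\cdots w_{a^n-1})$ be a De Bruijn cycle for $\{0,1,\ldots,a-1\}^n$. For $p\in\{0,1,\ldots,a^n-1\}$, let $w[p]=w_{-p}\cdots w_{-p+n-1}\,w_{-p}\cdots w_{-p+n-2}$ (with indices taken modulo $a^n$). Then $v=(w[0]\cdots w[a^n-1])$ is an $(a,n,2n-1)$-perfect necklace.
   Context: A cyclic word is a cyclically ordered sequence of letters, with indices taken modulo its length. A De Bruijn cycle for $\{0,\dots,a-1\}^n$ is a cyclic word $w=(w_0\cdots w_{a^n-1})$ over $\{0,\dots,a-1\}$ such that each word of $\{0,\dots,a-1\}^n$ equals $w_iw_{i+1}\cdots w_{i+n-1}$ for exactly one index $i$ modulo $a^n$. An $(a,n,t)$-perfect necklace is a cyclic word $v$ over $\{0,\dots,a-1\}$ of length $t\cdot a^n$ such that for every residue class $j$ modulo $t$, each word of $\{0,\dots,a-1\}^n$ equals $v_iv_{i+1}\cdots v_{i+n-1}$ for a unique index $i$ modulo $ta^n$ with $i\equiv j\pmod t$. Juxtaposition of words denotes concatenation; each $w[p]$ has length $2n-1$ (for $n=1$ the second block $w_{-p}\cdots w_{-p+n-2}$ is empty). *)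

(* Defs.v *)
From mathcomp Require Import all_boot all_order all_algebra.

Set Implicit Arguments.
Unset Strict Implicit.
Unset Printing Implicit Defensive.

Import GRing.Theory.

(* [u] is an element of {0, ..., a-1}^m *)
Definition is_word (a m : nat) (u : seq nat) : bool :=
  (size u == m) && all (fun x => x < a) u.

(* A cyclic word is given by one of its linear representatives [w : seq nat];
   [w_i] is read with [i : int] modulo the length of [w].  The default letter 0
   of [nth] is returned only when [w] is empty. *)
Definition letter (w : seq nat) (i : int) : nat :=
  nth 0 w `|(i %% (size w)%:Z)%Z|%N.

Definition factor (w : seq nat) (i : int) (m : nat) : seq nat :=
  [seq letter w (i + k%:Z)%R | k <- iota 0 m].

(* Indices modulo the length are represented by the naturals below it.  Both
   predicates below are invariant under rotation of the representative; for
   [perfect_necklace] this uses that t divides the length. *)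
Definition de_bruijn (a n : nat) (w : seq nat) : Prop :=
  is_word a (a ^ n) w /\
  forall u : seq nat, is_word a n u ->
    exists! i : nat, i < a ^ n /\ factor w i%:Z n = u.

Definition perfect_necklace (a n t : nat) (v : seq nat) : Prop :=
  is_word a (t * a ^ n) v /\
  forall j : nat, j < t ->
  forall u : seq nat, is_word a n u ->
    exists! i : nat,
      [/\ i < t * a ^ n, i = j %[mod t] & factor v i%:Z n = u].

(* w[p]; of length 2n-1 for n >= 1 *)
Definition block (n : nat) (w : seq nat) (p : nat) : seq nat :=
  factor w (- p%:Z)%R n ++ factor w (- p%:Z)%R (n - 1).

(* Main.v *)
(* Every window of length n of v is a rotation of a window of w.  Put
   t = 2n-1.  The window of v at pt+j is the window of w at -p rotated by j if
   j < n; if j >= n it runs into the block w[p+1] and is the window of w at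
   -(p+1) rotated by j-n+1.  For fixed j the rotation is a bijection on words
   and p |-> -p, p |-> -(p+1) are bijections modulo a^n, so the windows of v at
   positions congruent to j modulo t are as distinct and exhaustive as those
   of w. *)
Require Import Defs.
From mathcomp Require Import all_boot all_order all_algebra.
From mathcomp Require Import zify.

Set Implicit Arguments.
Unset Strict Implicit.
Unset Printing Implicit Defensive.

Import GRing.Theory.

Lemma eq_letter (w : seq nat) (i j : int) :
  (i = j %[mod (size w)%:Z])%Z -> letter w i = letter w j.
Proof. by rewrite /letter => ->. Qed.

Lemma eq_factor (w : seq nat) (i j : int) m :
  (i = j %[mod (size w)%:Z])%Z -> factor w i m = factor w j m.
Proof.
move=> ij; apply: eq_map => k; apply: eq_letter.
by rewrite -modzDml ij modzDml.
Qed.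

Lemma size_factor (w : seq nat) (i : int) m : size (factor w i m) = m.
Proof. by rewrite size_map size_iota. Qed.

Lemma nth_factor (w : seq nat) (i : int) m k :
  k < m -> nth 0 (factor w i m) k = letter w (i + k%:Z)%R.
Proof. by move=> km; rewrite (nth_map 0) ?size_iota // nth_iota. Qed.

Lemma factor_cat (w : seq nat) (i : int) m1 m2 :
  factor w i (m1 + m2) = factor w i m1 ++ factor w (i + m1%:Z)%R m2.
Proof.
rewrite /factor iotaD map_cat; congr (_ ++ _).
rewrite add0n -[X in iota X]addn0 iotaDl -map_comp; apply: eq_map => k /=.
by rewrite PoszD addrA.
Qed.

Lemma rot_factor (w : seq nat) (i : int) n r : r <= n ->
  rot r (factor w i n) = factor w (i + r%:Z)%R (n - r) ++ factor w i r.
Proof.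
move=> rn; rewrite -{1}(subnKC rn) factor_cat.
by rewrite -{1}(size_factor w i r) rot_size_cat.
Qed.

Lemma letter_lt a (w : seq nat) (i : int) :
  0 < size w -> all (fun x => x < a) w -> letter w i < a.
Proof.
move=> w0 /all_nthP; apply.
have := ltz_pmod i (_ : (0 < Posz (size w))%R).
have := modz_ge0 i (_ : Posz (size w) != 0%R).
lia.
Qed.

Lemma factor_all a (w : seq nat) (i : int) m :
  0 < size w -> all (fun x => x < a) w -> all (fun x => x < a) (factor w i m).
Proof.
by move=> w0 aw; apply/allP => _ /mapP[k _ ->]; apply: letter_lt.
Qed.

Lemma nth_flatten_uniform (T S : Type) (x0 : T) (y0 : S) (F : S -> seq T)
    t (s : seq S) p r :
  (forall y, size (F y) = t) -> p < size s -> r < t ->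
  nth x0 (flatten (map F s)) (p * t + r) = nth x0 (F (nth y0 s p)) r.
Proof.
move=> Ft; elim: s p => [//|y s IHs] [|p] /= ps rt; rewrite nth_cat Ft.
  by rewrite mul0n add0n rt.
by rewrite mulSn -addnA ltnNge leq_addr /= addKn IHs.
Qed.

Lemma size_flatten_uniform (T S : Type) (F : S -> seq T) t (s : seq S) :
  (forall y, size (F y) = t) -> size (flatten (map F s)) = size s * t.
Proof. by move=> Ft; elim: s => //= y s IHs; rewrite size_cat Ft IHs mulSn. Qed.

Lemma is_word_rotr a n r (u : seq nat) :
  is_word a n (rotr r u) = is_word a n u.
Proof.
rewrite /is_word size_rotr; congr (_ && _).
by apply: eq_all_r => x; rewrite mem_rotr.
Qed.

(** The blocks are counted by [size w], so that the window computations hold for any nonempty [w];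
    the De Bruijn property enters only in the theorem. *)
Definition necklace (n : nat) (w : seq nat) : seq nat :=
  flatten [seq block n w p | p <- iota 0 (size w)].

Section Necklace.

Variables (n : nat) (w : seq nat).
Hypothesis n_gt0 : 0 < n.
Hypothesis w_gt0 : 0 < size w.
Let t := 2 * n - 1.

Lemma size_block p : size (block n w p) = t.
Proof. by rewrite size_cat !size_factor /t; lia. Qed.

Lemma size_necklace : size (necklace n w) = t * size w.
Proof. by rewrite (size_flatten_uniform _ size_block) size_iota mulnC. Qed.

(** [P] is unbounded: both the necklace, read by blocks, and the starting index [- P] in [w] are
    periodic in [P] with period [size w]. This covers windows that wrap from the last block to block
    0. *)
Lemma letter_necklace (P r : nat) : r < t ->
  letter (necklace n w) (P * t + r)%:Z =
  letter w (- P%:Z + (if r < n then r else r - n)%N%:Z)%R.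
Proof.
move=> rt; rewrite {1}/letter size_necklace modz_nat absz_nat.
have -> : (P * t + r) %% (t * size w) = P %% size w * t + r.
  rewrite {1}(divn_eq P (size w)) mulnDl -mulnA (mulnC (size w)) -addnA modnMDl.
  rewrite modn_small //.
  have := ltn_pmod P w_gt0; nia.
rewrite (nth_flatten_uniform 0 0 size_block) ?size_iota ?ltn_pmod //.
rewrite nth_iota ?ltn_pmod // add0n /block nth_cat size_factor.
have Pw k : letter w (- (P %% size w)%N%:Z + k)%R = letter w (- P%:Z + k)%R.
  by apply: eq_letter; rewrite -modz_nat -modzDml modzNm modzDml.
by case: ltnP => rn; rewrite nth_factor ?Pw //; lia.
Qed.

Lemma factor_necklace_left (P r m : nat) : r + m <= n ->
  factor (necklace n w) (P * t + r)%:Z m = factor w (- P%:Z + r%:Z)%R m.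
Proof.
move=> rm; apply/eq_in_map => k; rewrite mem_iota add0n => /= km.
rewrite -PoszD -addnA letter_necklace; last by rewrite /t; lia.
by rewrite ifT ?PoszD ?addrA //; lia.
Qed.

Lemma factor_necklace_right (P r m : nat) : n <= r -> r + m <= t ->
  factor (necklace n w) (P * t + r)%:Z m = factor w (- P%:Z + (r - n)%N%:Z)%R m.
Proof.
move=> nr rm; apply/eq_in_map => k; rewrite mem_iota add0n => /= km.
rewrite -PoszD -addnA letter_necklace; last by lia.
by rewrite ifF; [congr letter; lia | lia].
Qed.

(** The window splits at the end of the copy in which it starts, and each piece lies inside a single
    copy; swapping the pieces gives back a window of [w]. *)
Lemma factor_necklace (p j : nat) : j < t ->
  factor (necklace n w) (p * t + j)%:Z n =
  rot (if j < n then j else j - n + 1)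
    (factor w (- (p + ~~ (j < n))%N%:Z)%R n).
Proof.
move=> jt; case: ltnP => jn /=.
  rewrite addn0 rot_factor 1?ltnW //.
  rewrite -[X in factor _ _ X = _](subnK (ltnW jn)) factor_cat.
  rewrite -PoszD -addnA subnKC 1?ltnW //.
  rewrite factor_necklace_left; last by lia.
  rewrite factor_necklace_right //; last by rewrite /t; lia.
  by rewrite subnn addr0.
have rn : j - n + 1 <= n by rewrite /t in jt; lia.
rewrite rot_factor // -[X in factor _ _ X = _](subnK rn) factor_cat.
rewrite -PoszD -addnA.
rewrite factor_necklace_right //; last by rewrite /t in jt *; lia.
(* The first piece ends exactly with block [p], since [n - (j - n + 1) = t - j]. *)
have -> : p * t + (j + (n - (j - n + 1))) = p.+1 * t + 0.
  by rewrite mulSn /t in jt *; lia.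
rewrite factor_necklace_left //.
(* Block [p.+1] starts one letter earlier in [w], so offset [j - n] from [- p] is offset [j - n + 1]
   from [- (p + 1)]. *)
by congr (factor _ _ _ ++ factor _ _ _); lia.
Qed.

End Necklace.

Theorem proposition4p4 (a n : nat) (ha : 2 <= a) (hn : 1 <= n)
    (w : seq nat) (hw : de_bruijn a n w) :
  perfect_necklace a n (2 * n - 1)
    (flatten [seq block n w p | p <- iota 0 (a ^ n)]).
Proof.
case: hw => /andP[/eqP sw aw] hw.
have N0 : 0 < a ^ n by rewrite expn_gt0; lia.
have w0 : 0 < size w by rewrite sw.
rewrite -sw -/(necklace n w); split.
  rewrite /is_word -sw size_necklace // eqxx /=.
  by apply/allP => x /flattenP[_ /mapP[p _ ->]]; rewrite mem_cat => /orP[];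
    apply/allP: x; apply: factor_all.
rewrite -sw in hw *; set N := size w in hw *; set t := 2 * n - 1 => j jt u hu.
(* [e] is 1 when the window runs into the next block, and [r] is the rotation; both depend on [j]
   only. *)
set e : nat := ~~ (j < n); set r := if j < n then j else j - n + 1.
have [i [[iN fi] i_uniq]] : exists! i, i < N /\ factor w i%:Z n = rotr r u.
  by apply: hw; rewrite is_word_rotr.
have N0' : Posz N != 0%R by lia.
have winE p : factor (necklace n w) (p * t + j)%:Z n = u <->
    (- (p + e)%N%:Z = i%:Z %[mod N%:Z])%Z.
  rewrite factor_necklace // -/e -/r; split=> [pu|pi]; last first.
    by rewrite (eq_factor _ pi) fi rotrK.
  (* Uniqueness of [i] concerns indices below [N], hence the reduced representative. *)
  set q := (- (p + e)%N%:Z %% N%:Z)%Z.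
  have q0 : (0 <= q)%R by apply: modz_ge0.
  have qN : (q < Posz N)%R by apply: ltz_pmod.
  have qE : Posz `|q|%N = q by lia.
  have <- // : `|q|%N = i; last by rewrite qE modz_mod.
  symmetry; apply: i_uniq; split; first by lia.
  by rewrite -pu rotK qE; apply: eq_factor; rewrite modz_mod.
(* The congruence [- (p + e) = i] modulo [N], solved for [p]. *)
set p := `|(- (i + e)%N%:Z %% N%:Z)%Z|%N.
have pE : Posz p = (- (i + e)%N%:Z %% N%:Z)%Z.
  by have := modz_ge0 (- (i + e)%N%:Z)%R N0'; rewrite /p; lia.
have pN : p < N.
  have := ltz_pmod (- (i + e)%N%:Z)%R (_ : (0 < Posz N)%R); rewrite -pE; lia.
have pP q : q < N -> (- (q + e)%N%:Z = i%:Z %[mod N%:Z])%Z <-> q = p.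
  move=> qN; split=> [qi|->].
    have : (q%:Z = - (i + e)%N%:Z %[mod N%:Z])%Z.
      have -> : (Posz q = - (- (q + e)%N%:Z) - e%:Z)%R by lia.
      by rewrite -modzDml -modzNm qi modzNm modzDml; congr modz; lia.
    by rewrite -pE modz_nat modn_small // => -[].
  have -> : (- (p + e)%N%:Z = - p%:Z - e%:Z)%R by lia.
  by rewrite -modzDml pE modzNm modzDml; congr modz; lia.
exists (p * t + j); split.
  split; [nia | by rewrite modnMDl | exact/winE/pP].
(* A competing position has remainder [j] modulo [t], so only its block number remains to be
   determined. *)
move=> i' [i'N i'j]; rewrite (divn_eq i' t) i'j (modn_small jt) => /winE.
have qN : i' %/ t < N by rewrite ltn_divLR 1?mulnC //; lia.
by move/(pP _ qN) ->.
Qed.
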